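(* Consider the multidimensional platform game of the context (finite electorate centrally symmetric around $\mu$, with potential $\Phi$). For every finite nonempty grid $\mathcal G\subset D$ and every $\tau>0$, the asynchronous logit revision process on $\mathcal G^2$ has the unique stationary distribution $$\Pi_\tau^{\mathcal G}(x_A,x_B)=\frac{\exp\{\Phi(x_A,x_B)/\tau\}}{\sum_{(y_A,y_B)\in\mathcal G^2}\exp\{\Phi(y_A,y_B)/\tau\}}.$$ Let $\mathcal M_{\mathcal G}=\arg\max_{(x_A,x_B)\in\mathcal G^2}\Phi(x_A,x_B)$. As $\tau\downarrow0$, $\Pi_\tau^{\mathcal G}(x)\to|\mathcal M_{\mathcal G}|^{-1}$ if $x\in\mathcal M_{\mathcal G}$ and $\Pi_\tau^{\mathcal G}(x)\to0$ if $x\notin\mathcal M_{\mathcal G}$; thus the stochastically stable profiles (those whose stationary probability does not vanish as $\tau\downarrow 0$) are exactly the global maximizers of $\Phi$ on $\mathcal G^2$. Moreover, let $(\mathcal G_n)_{n\ge1}$ be finite grids in $D$ with $\sup_{x\in D}\min_{y\in\mathcal G_n}\|x-y\|\to0$. If $x^n\in\mathcal M_{\mathcal G_n}$ for each $n$, every accumulation point of $(x^n)$ belongs to $\arg\max_{x\in D^2}\Phi(x)$. If in addition $\nu$ is strictly concave on $[0,1]$, every such limiting profile is a party-preferred Nash equilibrium of the unrestricted game.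
   Context: $K\ge2$. There are $N\ge2$ voter types with shares $s_i>0$, $\sum_is_i=1$, and distinct bliss points $x_i\in\mathbb R^K$; for every $i$ there is $\bar i$ with $x_{\bar i}=2\mu-x_i$ and $s_{\bar i}=s_i$. Parties $A,B$ simultaneously choose platforms in $\mathbb R^K$ (unrestricted game). Let $\Delta_i(x_A,x_B)=\|x_B-x_i\|^2-\|x_A-x_i\|^2$. A common shock $\epsilon$ is uniform on $[-\phi,\phi]$. Let $D=\prod_{k=1}^K[\min_ix_i^k,\max_ix_i^k]$; wide support: $\phi>\sup_{a,b\in D,\,i}|\Delta_i(a,b)|$. Vote shares are $S_A(\epsilon)=\sum_is_i\mathbf 1\{\Delta_i\ge\epsilon\}$, $S_B=1-S_A$. The power rule $\rho:[0,1]\to\mathbb R$ is strictly increasing (possibly discontinuous) with $\rho(s)+\rho(1-s)=\bar\rho$ for all $s$; $U:[\rho(0),\rho(1)]\to\mathbb R$ is continuous, strictly increasing, strictly concave; $\nu=U\circ\rho$ with $\nu(1)-\nu(0)=1$. Payoffs are $V_p(x_A,x_B)=\mathbb E_\epsilon[\nu(S_p(\epsilon))]$. The potential is $\Phi(x_A,x_B)=V_A(x_A,x_B)-\|x_B-\mu\|^2/\phi$ on $D^2$. A pure-strategy Nash equilibrium is party-preferred if it maximizes each party's payoff among all pure-strategy Nash equilibria of the unrestricted game. Asynchronous logit process on $\mathcal G^2$: time is discrete; at each date one party $p\in\{A,B\}$ is selected to revise with fixed probability $\chi_p>0$, $\chi_A+\chi_B=1$. Given the opponent's current platform $x_{-p}$,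 the revising party chooses $y\in\mathcal G$ with probability $$L_{p,\tau}(y\mid x_{-p})=\frac{\exp\{V_p(y,x_{-p})/\tau\}}{\sum_{z\in\mathcal G}\exp\{V_p(z,x_{-p})/\tau\}},$$ where $V_p(y,x_{-p})$ is $p$'s payoff when $p$ plays $y$ and the opponent plays $x_{-p}$; the other party's platform is unchanged. *)

(* Defs.v *)
From HB Require Import structures.
From mathcomp Require Import all_boot all_order all_algebra finmap.
From mathcomp Require Import all_classical all_reals all_analysis.

Set Implicit Arguments.
Unset Strict Implicit.
Unset Printing Implicit Defensive.

Import Order.TTheory GRing.Theory Num.Theory.
Import numFieldNormedType.Exports.

Local Open Scope classical_set_scope.
Local Open Scope ring_scope.

Section Generic.
Variable R : realType.

(* The library norm on row vectors is the sup norm, hence a separate Euclidean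
   norm; both induce the topology that the library puts on 'rV[R]_K. *)
Definition enorm (K : nat) (v : 'rV[R]_K) : R :=
  Num.sqrt (\sum_(k < K) v 0 k ^+ 2).

Definition strictly_concave_on (I : set R) (f : R -> R) : Prop :=
  forall a b t : R, I a -> I b -> a != b -> 0 < t -> t < 1 ->
    t * f a + (1 - t) * f b < f (t * a + (1 - t) * b).

Definition argmax (T : Type) (S : set T) (f : T -> R) : set T :=
  [set z | S z /\ forall w, S w -> f w <= f z].

Definition stationary (S : finType) (P : S -> S -> R) (pi : S -> R) : Prop :=
  [/\ forall z, 0 <= pi z,
      \sum_z pi z = 1 &
      forall w, \sum_z pi z * P z w = pi w].

Definition utility_gap (K : nat) (t a b : 'rV[R]_K) : R :=
  enorm (b - t) ^+ 2 - enorm (a - t) ^+ 2.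

(* inf and sup are taken over a finite family, so for N > 0 they are min and
   max. *)
Definition bounding_box (K N : nat) (x : 'I_N -> 'rV[R]_K) : set 'rV[R]_K :=
  [set a | forall k, inf (range (fun i => x i 0 k)) <= a 0 k
                       <= sup (range (fun i => x i 0 k))].

End Generic.

(* rho and U are total functions constrained only on [0, 1] and on
   [rho 0, rho 1]; no other value enters the payoffs. *)
Record platform_game (R : realType) (K N : nat) := PlatformGame {
  bliss : 'I_N -> 'rV[R]_K;
  share : 'I_N -> R;
  center : 'rV[R]_K;
  phi : R;
  rho : R -> R;
  rho_bar : R;
  U : R -> R;
  dim_ge2 : (2 <= K)%N;
  types_ge2 : (2 <= N)%N;
  share_gt0 : forall i, 0 < share i;
  share_sum1 : \sum_i share i = 1;
  bliss_inj : injective bliss;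
  central_symmetry : forall i, exists j,
    bliss j = 2 *: center - bliss i /\ share j = share i;
  phi_gt0 : 0 < phi;
  wide_support :
    (ereal_sup [set (`| utility_gap (bliss i) ab.1 ab.2 |)%:E
               | i in [set: 'I_N]
               & ab in bounding_box bliss `*` bounding_box bliss] < phi%:E)%E;
  rho_increasing : {in `[0, 1] &, {homo rho : a b / a < b}};
  rho_symmetric : {in `[0, 1], forall a, rho a + rho (1 - a) = rho_bar};
  U_continuous : {within `[rho 0, rho 1], continuous U};
  U_increasing : {in `[rho 0, rho 1] &, {homo U : a b / a < b}};
  U_strictly_concave : strictly_concave_on `[rho 0, rho 1] U;
  U_rho_normalized : U (rho 1) - U (rho 0) = 1
}.

Inductive party := PartyA | PartyB.

(* Profiles are pairs (x_A, x_B); [play p y o] is the profile in which p plays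
   y and the opponent of p plays o. *)
Definition own (T : Type) (p : party) (z : T * T) : T :=
  if p is PartyA then z.1 else z.2.
Definition opp (T : Type) (p : party) (z : T * T) : T :=
  if p is PartyA then z.2 else z.1.
Definition play (T : Type) (p : party) (y o : T) : T * T :=
  if p is PartyA then (y, o) else (o, y).

Notation profile R K := ('rV[R]_K * 'rV[R]_K)%type.

Section Game.
Variables (R : realType) (K N : nat) (g : platform_game R K N).

Definition D : set 'rV[R]_K := bounding_box (bliss g).

Definition Delta (i : 'I_N) (z : profile R K) : R :=
  utility_gap (bliss g i) z.1 z.2.

Definition nu (v : R) : R := U g (rho g v).

Definition vote_share (p : party) (z : profile R K) (e : R) : R :=
  let SA := \sum_i share g i * (e <= Delta i z)%R%:R in
  if p is PartyA then SA else 1 - SA.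

Definition shock : probability _ R := uniform_prob (gtrN (phi_gt0 g)).

Definition V (p : party) (z : profile R K) : R :=
  fine ('E_shock [fun e => nu (vote_share p z e)])%E.

Definition Phi (z : profile R K) : R :=
  V PartyA z - enorm (z.2 - center g) ^+ 2 / phi g.

Definition nash (z : profile R K) : Prop :=
  forall (p : party) (y : 'rV[R]_K), V p (play p y (opp p z)) <= V p z.

Definition party_preferred (z : profile R K) : Prop :=
  nash z /\ forall (p : party) (w : profile R K), nash w -> V p w <= V p z.

Section Grid.
Variable G : {fset 'rV[R]_K}.

Definition emb (z : G * G) : profile R K := (fsval z.1, fsval z.2).

Definition logit (p : party) (tau : R) (y o : G) : R :=
  expR (V p (emb (play p y o)) / tau) /
  \sum_(z : G) expR (V p (emb (play p z o)) / tau).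

Definition revision (chi : party -> R) (tau : R) (z w : G * G) : R :=
  chi PartyA * (logit PartyA tau w.1 z.2 * (w.2 == z.2)%:R) +
  chi PartyB * (logit PartyB tau w.2 z.1 * (w.1 == z.1)%:R).

Definition gibbs (tau : R) (z : G * G) : R :=
  expR (Phi (emb z) / tau) / \sum_(y : G * G) expR (Phi (emb y) / tau).

Definition maximizers : {set G * G} :=
  [set z | [forall w, Phi (emb w) <= Phi (emb z)]].

Definition stochastically_stable (chi : party -> R) (z : G * G) : Prop :=
  exists pi : R -> G * G -> R,
    (forall tau, 0 < tau -> stationary (revision chi tau) (pi tau)) /\
    ~ (pi tau z @[tau --> 0^'+] --> 0).

End Grid.

(* sup over x in D of min over y in G of the distance; the minimum is over a
   finite set, and is +oo when G is empty. *)
Definition mesh (G : {fset 'rV[R]_K}) : \bar R :=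
  ereal_sup [set ereal_inf [set (enorm (x - y))%:E | y in [set` G]] | x in D].

End Game.

(* Main.v *)
From HB Require Import structures.
From mathcomp Require Import all_boot all_order all_algebra finmap.
From mathcomp Require Import all_classical all_reals all_analysis.
From mathcomp Require Import lra ring.
Require Import Defs.

(** A voter type switches between the parties at the shock equal to its utility
    gap. Ordering the types by decreasing gap and letting [w i] be the increment
    of [nu] when type [i] joins gives
    [nu (S_A e) = nu 0 + \sum_i w i * (e <= Delta i)] for all [e], so the payoff
    is [nu 0 + \sum_i w i * cdf (Delta i)] with [cdf] the distribution function
    of the shock.

    Central symmetry makes the gaps symmetric about
    [|x_B - mu|^2 - |x_A - mu|^2], whence
    [V_A - V_B = (|x_B - mu|^2 - |x_A - mu|^2) / phi] on [D^2] and [Phi] is an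
    exact potential there. Hence the logit revision is a mixture of Gibbs
    resamplings of one coordinate, which preserves the Gibbs measure; any two
    profiles are joined by two revisions, which gives uniqueness.

    Clipping a platform to the box [D] brings it closer to every bliss point, so
    maximizers of [Phi] on [D^2] are equilibria of the unrestricted game and all
    equilibria lie in [D^2]. If [nu] is strictly concave, the greedy weights of a
    profile give a minorant of the payoff at every other profile; deviating to
    the barycenter [m = \sum_i w i *: x_i] shows that an equilibrium satisfies
    [x_A = m] and [x_B = 2 mu - m]. Then
    [V_A = V_B = 2 Phi - (nu 0 + 1 / 2)] at every equilibrium, so maximizing
    [Phi] maximizes both payoffs among equilibria. *)

Set Implicit Arguments.
Unset Strict Implicit.
Unset Printing Implicit Defensive.

Import Order.TTheory GRing.Theory Num.Theory.
Import numFieldNormedType.Exports.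

Local Open Scope classical_set_scope.
Local Open Scope ring_scope.

(** * The uniform shock *)

(** Clamping [t] to [[- r, r]] gives the distribution function of the uniform law on that interval,
    off the support as well. *)
Definition uniform_cdf (R : realType) (r t : R) : R :=
  (Num.max (- r) (Num.min r t) + r) / (2 * r).

Section SimpleFunctions.
Variables (d : measure_display) (T : measurableType d) (R : realType).
Variables (P : probability T R) (I : finType).
Variables (c : R) (w : I -> R) (A : I -> set T).
Hypothesis mA : forall i, measurable (A i).

Let F e := c + \sum_i w i * \1_(A i) e.

Let integrable_term i : P.-integrable setT (EFin \o (fun e => w i * \1_(A i) e)).
Proof.
have -> : EFin \o (fun e => w i * \1_(A i) e) =
    (fun e => (w i)%:E * (\1_(A i) e)%:E)%E by apply/funext => e /=; rewrite EFinM.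
by apply: integrableZl => //; apply: integrable_indic.
Qed.

Let integrable_terms (s : seq I) :
  P.-integrable setT (EFin \o (fun e => \sum_(i <- s) w i * \1_(A i) e)).
Proof.
have -> : EFin \o (fun e => \sum_(i <- s) w i * \1_(A i) e) =
    (fun e => \sum_(i <- s) (w i * \1_(A i) e)%:E)%E.
  by apply/funext => e /=; rewrite sumEFin.
by apply: integrable_sum => // i _; exact: integrable_term.
Qed.

Let integrable_const : P.-integrable setT (EFin \o (fun=> c)).
Proof. exact: finite_measure_integrable_cst. Qed.

Lemma integrable_simple : P.-integrable setT (EFin \o F).
Proof.
have -> : EFin \o F =
    (fun e => c%:E + (\sum_i w i * \1_(A i) e)%:E)%E by [].
apply: (@integrableD _ _ _ P setT) => //; exact: integrable_terms.
Qed.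

Lemma Rintegral_simple :
  (\int[P]_e F e) = c + \sum_i w i * fine (P (A i)).
Proof.
rewrite (RintegralD measurableT integrable_const (integrable_terms _)).
rewrite Rintegral_cst //= probability_setT mulr1; congr (_ + _).
elim: (index_enum I) => [|i s IH].
  under eq_Rintegral do rewrite big_nil.
  by rewrite Rintegral_cst // mul0r big_nil.
under eq_Rintegral do rewrite big_cons.
rewrite (RintegralD measurableT (integrable_term _) (integrable_terms _)).
rewrite big_cons IH.
congr (_ + _); rewrite RintegralZl//.
  by congr (_ * _); rewrite /Rintegral integral_indic // setIT.
by apply: integrable_indic.
Qed.

End SimpleFunctions.

Section Uniform.
Variables (R : realType) (r : R).
Hypothesis r_gt0 : 0 < r.
Let P : probability _ R := uniform_prob (gtrN r_gt0).

Lemma uniform_prob_le t : fine (P `]-oo, t]%classic) = uniform_cdf r t.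
Proof.
have E : [set` `]-oo, t]] `&` [set` `[- r, r]] = [set` `[- r, Num.min r t]] :> set R.
  apply/seteqP; split => x /=; rewrite !in_itv/= le_min.
    by move=> [-> /andP[-> ->]].
  by move=> /andP[-> /andP[-> ->]].
have -> : P `]-oo, t]%classic = (((r - - r)^-1)%R%:E *
    lebesgue_measure [set` `[(- r)%R, (Num.min r t)%R]])%E.
  rewrite -(setIT `]-oo, t]%classic) -integral_indic//.
  rewrite integral_uniform//; last exact/measurable_realfun.measurable_EFinP.
  by rewrite integral_indic// E.
rewrite lebesgue_measure_itv /= lte_fin /uniform_cdf opprK -mulr2n -[r *+ 2]mulr_natl.
(* When [t <= - r] the interval is null, and the clamp at [- r] also gives 0. *)
case: ltP => _.
  by rewrite -EFinD -EFinM /= mulrC.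
by rewrite mule0 addNr mul0r.
Qed.

Lemma uniform_prob_gt t : fine (P `]t, +oo[%classic) = 1 - uniform_cdf r t.
Proof.
rewrite -uniform_prob_le -setCitvl probability_setC//.
have : P `]-oo, t]%classic \is a fin_num by apply: fin_num_measure.
by case: (P `]-oo, t]%classic).
Qed.

Lemma uniform_cdfN t : uniform_cdf r (- t) = 1 - uniform_cdf r t.
Proof.
rewrite /uniform_cdf; have r2 : 2 * r != 0 by rewrite mulf_neq0 ?gt_eqF.
apply: (mulIf r2); rewrite mulrBl !divfK // mul1r {r2}.
by case: (leP r t) => ?; case: (leP r (- t)) => ?; do ?case: leP => ?;
  move: r_gt0; lra.
Qed.

Lemma uniform_cdf_in t : - r <= t <= r -> uniform_cdf r t = 2^-1 + t / (2 * r).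
Proof.
move=> /andP[h1 h2]; rewrite /uniform_cdf (min_idPr h2) (max_idPr h1) mulrDl addrC.
by congr (_ + _); field; exact: lt0r_neq0.
Qed.

Lemma uniform_cdf_out t : t <= - r -> uniform_cdf r t = 0.
Proof.
by move=> h; rewrite /uniform_cdf min_r ?max_l ?addNr ?mul0r//; move: h r_gt0; lra.
Qed.

Lemma uniform_cdf_lip s t : s <= t ->
  uniform_cdf r t - uniform_cdf r s <= (t - s) / (2 * r).
Proof.
move=> st; rewrite /uniform_cdf -mulrBl ler_pM2r; last by rewrite invr_gt0 mulr_gt0.
by case: (leP r t) => ?; case: (leP r s) => ?;
  do ?case: (leP (- r) _) => ?; move: r_gt0 st; lra.
Qed.

Lemma uniform_cdf_homo : {homo uniform_cdf r : s t / s <= t}.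
Proof.
move=> s t st; rewrite /uniform_cdf ler_pM2r; last by rewrite invr_gt0 mulr_gt0.
by case: (leP r t) => ?; case: (leP r s) => ?;
  do ?case: (leP (- r) _) => ?; move: r_gt0 st; lra.
Qed.

Lemma uniform_cdf_lt s t : s < r -> - r < t -> s < t ->
  uniform_cdf r s < uniform_cdf r t.
Proof.
move=> sr rt st; rewrite /uniform_cdf ltr_pM2r; last by rewrite invr_gt0 mulr_gt0.
by case: (leP r t) => ?; case: (leP r s) => ?;
  do ?case: (leP (- r) _) => ?; move: r_gt0 st sr rt; lra.
Qed.

Lemma uniform_cdf_ge_half t : 0 <= t -> 2^-1 <= uniform_cdf r t.
Proof.
move=> t0; apply: le_trans (uniform_cdf_homo t0).
by rewrite uniform_cdf_in ?mul0r ?addr0//; move: r_gt0; lra.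
Qed.

End Uniform.

(** * Marginal weights of a set function *)

Section MarginalWeights.
Variables (R : realType) (I : finType) (s t : I -> R) (f : R -> R).

(** With [t] the utility gaps, the electorates of a party at the various shocks have this form. *)
Definition upper_pred (X : pred I) := forall i j, t i <= t j -> X i -> X j.

Definition increasing01 := {in `[0, 1] &, {homo f : a b / a < b}}.

(** The form of concavity that makes the set function [f (\sum_(i in X) s i)] submodular. *)
Definition decreasing_increments := forall a b c : R,
  0 <= a -> a <= b -> 0 < c -> b + c <= 1 -> f (b + c) - f b <= f (a + c) - f a.

Hypothesis s_gt0 : forall i, 0 < s i.

(** Induction on the sorted list, with [b] the mass of the types already placed. In the last clause
    the base [a] may lag behind [b], because types outside [X] add to [b] only. *)
Lemma marginal_weights_seq (l : seq I) (b : R) :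
  uniq l -> sorted (fun i j => t j <= t i) l ->
  0 <= b -> b + \sum_(i <- l) s i <= 1 ->
  exists w : I -> R,
  [/\ forall X, upper_pred X ->
        f (b + \sum_(i <- l) s i * (X i)%:R) = f b + \sum_(i <- l) w i * (X i)%:R,
      increasing01 -> forall i, i \in l -> 0 < w i &
      decreasing_increments -> forall (X : pred I) a, 0 <= a -> a <= b ->
        \sum_(i <- l) w i * (X i)%:R <= f (a + \sum_(i <- l) s i * (X i)%:R) - f a].
Proof.
elim: l b => [|i l IH] b.
  by move=> _ _ b0 _; exists (fun=> 0); split => // *;
     rewrite !big_nil ?addr0// subrr.
move=> /=/andP[il ul] pl b0; rewrite big_cons addrA => bs1.
have bi0 : 0 <= b + s i by rewrite addr_ge0 // ltW.
have [w [wA wB wC]] := IH _ ul (path_sorted pl) bi0 bs1.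
have bi1 : b + s i <= 1.
  by apply: le_trans bs1; rewrite lerDl sumr_ge0 // => j _; rewrite ltW.
have mini : {in l, forall j, t j <= t i}.
  by apply/allP; apply: order_path_min pl => x y z yx zy; exact: le_trans zy yx.
pose w' j := if j == i then f (b + s i) - f b else w j.
have w'l (X : pred I) :
    \sum_(j <- l) w' j * (X j)%:R = \sum_(j <- l) w j * (X j)%:R.
  apply: eq_big_seq => j jl; rewrite /w'.
  by case: eqP => // ji; rewrite -ji jl in il.
exists w'; split=> [X Xup|finc j|fdec X a a0 ab].
- rewrite !big_cons w'l /w' eqxx; case: (boolP (X i)) => Xi.
    by rewrite !mulr1 addrA wA // addrA subrKC.
  (* The head has the largest [t], so an upper set that misses it is empty on the list. *)
  have X0 j : j \in l -> X j = false.
    by move=> jl; apply: contraNF Xi; apply: Xup; exact: mini.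
  rewrite !mulr0 !add0r !big_seq.
  by rewrite !big1 ?addr0 // => j jl; rewrite X0 ?mulr0.
- rewrite in_cons /w'; case: eqP => [_ _|_ /=]; last exact: wB.
  rewrite subr_gt0; apply: finc; rewrite ?in_itv/= ?b0 ?bi0 ?bi1 ?ltrDl//.
  by rewrite (le_trans _ bi1) // lerDl ltW.
- rewrite !big_cons w'l /w' eqxx; case: (boolP (X i)) => Xi.
    rewrite !mulr1 addrA.
    have := wC fdec X (a + s i) (addr_ge0 a0 (ltW (s_gt0 i))) (lerD ab (lexx _)).
    by have := fdec a b (s i) a0 ab (s_gt0 i) bi1; lra.
  rewrite !mulr0 !add0r; apply: wC => //.
  by rewrite (le_trans ab) // lerDl ltW.
Qed.

Hypothesis s_sum1 : \sum_i s i = 1.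

(* The weight of [i] is the increment of [f] when [s i] is added to the mass of
   the types placed before [i] in a fixed [t]-decreasing order: these are the
   vertices of the base polytope of the set function [f (\sum_(i in X) s i)], and
   the inequality is its submodularity. *)
Lemma marginal_weights : exists w : I -> R,
  [/\ forall X, upper_pred X ->
        f (\sum_i s i * (X i)%:R) = f 0 + \sum_i w i * (X i)%:R,
      increasing01 -> forall i, 0 < w i &
      decreasing_increments -> forall (X : pred I),
        \sum_i w i * (X i)%:R <= f (\sum_i s i * (X i)%:R) - f 0].
Proof.
pose r i j := t j <= t i.
pose l := sort r (enum I).
have tot : total r by move=> i j; exact: le_total.
have pl : perm_eq l (index_enum I).
  by rewrite (perm_trans (permEl (perm_sort _ _))) // enumT.
have [||//||w [wA wB wC]] := @marginal_weights_seq l 0.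
- by rewrite sort_uniq enum_uniq.
- exact: sort_sorted.
- by rewrite add0r (perm_big _ pl) s_sum1.
exists w; split => [X Xup|finc i|fdec X].
- by have := wA X Xup; rewrite add0r !(perm_big _ pl).
- by apply: wB => //; rewrite mem_sort mem_enum.
- by have := wC fdec X 0 (lexx _) (lexx _); rewrite add0r !(perm_big _ pl).
Qed.

End MarginalWeights.

(** Both [a + c] and [b] are convex combinations of [a] and [b + c], with exchanged weights; the two
    concavity inequalities add up to the claim. *)
Lemma strictly_concave_increments (R : realType) (f : R -> R) :
  strictly_concave_on `[0, 1] f -> decreasing_increments f.
Proof.
move=> fconc a b c a0 ab c0 bc1.
have [->|nab] := eqVneq a b; first by [].
have lab : a < b by rewrite lt_neqAle nab.
pose d := b + c - a; have d0 : 0 < d by rewrite /d; move: lab c0; lra.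
have dn0 : d != 0 by rewrite gt_eqF.
have a01 : [set` `[0, 1]] a by rewrite /= in_itv/=; apply/andP; split; lra.
have bc01 : [set` `[0, 1]] (b + c) by rewrite /= in_itv/=; apply/andP; split; lra.
have abc : a != b + c by rewrite lt_eqF //; lra.
have cab : b + c != a by rewrite eq_sym.
have c1 : c / d < 1 by rewrite ltr_pdivrMr // mul1r /d; lra.
have h1 := fconc a (b + c) (c / d) a01 bc01 abc (divr_gt0 c0 d0) c1.
have h2 := fconc (b + c) a (c / d) bc01 a01 cab (divr_gt0 c0 d0) c1.
move: h1 h2.
have -> : c / d * (b + c) + (1 - c / d) * a = a + c by rewrite /d; field.
have -> : c / d * a + (1 - c / d) * (b + c) = b by rewrite /d; field.
by lra.
Qed.

(** * Expected payoffs as functions of the utility gaps *)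

Section Payoffs.
Variables (R : realType) (K N : nat) (g : platform_game R K N).
Implicit Types (d : 'I_N -> R) (X Y : pred 'I_N).

Lemma nu_increasing : increasing01 (nu g).
Proof.
have rin v : v \in `[0, 1] -> rho g v \in `[rho g 0, rho g 1].
  have rle : {in `[0, 1] &, {homo rho g : a b / a <= b}}.
    move=> a b ha hb; rewrite le_eqVlt => /predU1P[->//|ab].
    by rewrite ltW //; exact: rho_increasing.
  move=> hv; have := hv; rewrite !in_itv/= => /andP[v0 v1].
  by rewrite !rle // in_itv/= ?lexx ?ler01.
move=> a b ha hb ab; rewrite /nu; apply: U_increasing; rewrite ?rin //.
exact: rho_increasing.
Qed.

Lemma nu_range : nu g 1 = nu g 0 + 1.
Proof. by have := U_rho_normalized g; rewrite /nu; lra. Qed.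

Definition mass X : R := \sum_i share g i * (X i)%:R.

Lemma massT : mass xpredT = 1.
Proof. by rewrite -(share_sum1 g); apply: eq_bigr => i _; rewrite mulr1. Qed.

Lemma le_mass X Y : (forall i, X i -> Y i) -> mass X <= mass Y.
Proof.
move=> XY; apply: ler_sum => i _; apply: ler_wpM2l; first by rewrite ltW // share_gt0.
by by rewrite ler_nat; have := XY i; case: (X i) => // ->.
Qed.

Lemma mass_itv X : mass X \in `[0, 1].
Proof.
rewrite in_itv/= -massT le_mass // andbT; apply: sumr_ge0 => i _.
by rewrite mulr_ge0 // ltW // share_gt0.
Qed.

Lemma le_nu_mass X Y : (forall i, X i -> Y i) -> nu g (mass X) <= nu g (mass Y).
Proof.
move=> /le_mass; rewrite le_eqVlt => /predU1P[->//|XY].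
by rewrite ltW //; apply: nu_increasing; rewrite ?mass_itv.
Qed.

Lemma mass0 : mass pred0 = 0.
Proof. by rewrite /mass big1 // => i _; rewrite mulr0. Qed.

Lemma nu_mass_bounds X : nu g 0 <= nu g (mass X) <= nu g 0 + 1.
Proof. by rewrite -nu_range -{1}mass0 -massT !le_nu_mass. Qed.

(** The gain from adding type [i] is positive for each of finitely many electorates, hence bounded
    below by its minimum. This uniform gap turns strict gains at single shocks into strict gains in
    expectation. *)
Lemma nu_mass_gap i :
  exists2 k, 0 < k & forall X Y, (forall j, X j -> Y j) -> ~~ X i -> Y i ->
    k <= nu g (mass Y) - nu g (mass X).
Proof.
pose gap (A : {set 'I_N}) := nu g (mass (mem (i |: A))) - nu g (mass (mem A)).
have i0 : i \notin (finset.set0 : {set 'I_N}) by rewrite finset.inE.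
case: (@arg_minP _ _ _ finset.set0 (fun A => i \notin A) gap i0) => A iA minA.
exists (gap A) => [|X Y XY Xi Yi].
  rewrite subr_gt0; apply: nu_increasing; rewrite ?mass_itv //.
  rewrite /mass (bigD1 i) //= [ltRHS](bigD1 i) //= setU11 (negbTE iA) mulr0 mulr1.
  rewrite [X in _ < _ + X](eq_bigr (fun j => share g j * (j \in A)%:R)).
    by rewrite ltrD2r share_gt0.
  by move=> j /negbTE ji; rewrite finset.in_setU1 ji.
have := minA [set j | X j]%SET; rewrite finset.inE => /(_ Xi) /le_trans; apply.
rewrite /gap; have -> : mass (mem [set j | X j]%SET) = mass X.
  by apply: eq_bigr => j _; rewrite /= finset.inE.
rewrite lerD2r le_nu_mass // => j /=; rewrite finset.in_setU1 finset.inE.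
by case/orP => [/eqP ->|/XY].
Qed.

Notation cdf := (uniform_cdf (phi g)).
Notation P := (shock g).

Definition turnout_payoff d (e : R) : R := nu g (mass (fun i => e <= d i)).

Definition expected_payoff d : R := \int[P]_e turnout_payoff d e.

Let ray (t : R) : set (g_sigma_algebraType R.-ocitv.-measurable) := [set` `]-oo, t]].

Let step c w d (e : R) : R := c + \sum_i w i * (e <= d i)%R%:R.

Let step_indic c w d :
  step c w d = (fun e => c + \sum_i w i * \1_(ray (d i)) e).
Proof.
apply/funext => e; congr (_ + _); apply: eq_bigr => i _; congr (_ * _).
by rewrite indicE mem_setE in_itv.
Qed.

Let integrable_step c w d : P.-integrable setT (EFin \o step c w d).
Proof. by rewrite step_indic; apply: integrable_simple => i; exact: measurable_itv. Qed.

Let Rintegral_step c w d :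
  (\int[P]_e step c w d e) = c + \sum_i w i * cdf (d i).
Proof.
rewrite step_indic Rintegral_simple; last by move=> i; exact: measurable_itv.
by congr (_ + _); apply: eq_bigr => i _; rewrite uniform_prob_le.
Qed.

Let upper_lt d e : upper_pred d (fun i => e < d i).
Proof. by move=> i j ij ei; exact: lt_le_trans ei ij. Qed.

(** The third clause makes the payoff at [d] a weighted sum of distribution functions; the fourth
    makes the same sum a minorant at all other gap vectors. *)
Definition representing_weights d (w : 'I_N -> R) := 
  [/\ forall i, 0 < w i, \sum_i w i = 1,
      forall X, upper_pred d X -> nu g (mass X) = nu g 0 + \sum_i w i * (X i)%:R &
      decreasing_increments (nu g) -> forall X,
        nu g 0 + \sum_i w i * (X i)%:R <= nu g (mass X)].

Lemma representing_weights_ex d : exists w, representing_weights d w.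
Proof.
have [w [wA wB wC]] := marginal_weights d (nu g) (share_gt0 g) (share_sum1 g).
exists w; split => // [i||dec X].
- by apply: wB; exact: nu_increasing.
- have := wA xpredT (fun _ _ _ _ => isT); rewrite -/(mass xpredT) massT nu_range.
  by move/addrI => ->; apply: eq_bigr => i _; rewrite mulr1.
- by have := wC dec X; rewrite -/(mass X); lra.
Qed.

Lemma turnout_payoffE d w : representing_weights d w ->
  turnout_payoff d = step (nu g 0) w d.
Proof.
case=> _ _ wA _; apply/funext => e; rewrite /turnout_payoff wA //.
by move=> i j ij ei; exact: le_trans ei ij.
Qed.

Lemma integrable_turnout d : P.-integrable setT (EFin \o turnout_payoff d).
Proof.
by have [w /turnout_payoffE ->] := representing_weights_ex d; exact: integrable_step.
Qed.

Lemma expected_payoffE d w : representing_weights d w ->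
  expected_payoff d = nu g 0 + \sum_i w i * cdf (d i).
Proof. by move=> /turnout_payoffE dw; rewrite /expected_payoff dw Rintegral_step. Qed.

(** A common translation of the gaps keeps their order, hence the upper sets and the weights. *)
Lemma expected_payoff_shift d w c : representing_weights d w ->
  expected_payoff (fun i => d i - c) = nu g 0 + \sum_i w i * cdf (d i - c).
Proof.
case=> w0 w1 wA wC; apply: (expected_payoffE (d := fun i => d i - c)); split=> // X Xup.
by apply: wA => i j ij; apply: Xup; rewrite lerD2r.
Qed.

Lemma le_expected_payoff_concave d d' w : decreasing_increments (nu g) ->
  representing_weights d w ->
  nu g 0 + \sum_i w i * cdf (d' i) <= expected_payoff d'.
Proof.
move=> dec [_ _ _ wC]; rewrite -(Rintegral_step (nu g 0) w d').
apply: (le_Rintegral measurableT (integrable_step _ _ _) (integrable_turnout _)) => e _.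
exact: wC.
Qed.

(* Weights representing [d] also represent the strict upper sets of [d], which
   are the electorates of the opponent after reversal of the shock. *)
Lemma expected_payoff_opponent d :
  (\int[P]_e nu g (1 - mass (fun i => e <= d i))) = expected_payoff (fun i => - d i).
Proof.
have [w dw] := representing_weights_ex (fun i => - d i).
rewrite (expected_payoffE dw); have [_ _ wA _] := dw.
pose ray' (t : R) : set (g_sigma_algebraType R.-ocitv.-measurable) := [set` `]t, +oo[].
have E e : nu g (1 - mass (fun i => e <= d i)) =
    nu g 0 + \sum_i w i * \1_(ray' (d i)) e.
  have -> : 1 - mass (fun i => e <= d i) = mass (fun i => - e < - d i).
    rewrite -massT /mass -sumrB; apply: eq_bigr => i _; rewrite -mulrBr ltrN2 ltNge.
    by case: (e <= d i); rewrite /= ?subrr ?subr0.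
  rewrite wA; last exact: upper_lt.
  congr (_ + _); apply: eq_bigr => i _; congr (_ * _).
  by rewrite indicE mem_setE in_itv/= andbT ltrN2.
under eq_Rintegral do rewrite E.
rewrite Rintegral_simple; last by move=> i; exact: measurable_itv.
by congr (_ + _); apply: eq_bigr => i _; rewrite uniform_prob_gt uniform_cdfN ?phi_gt0.
Qed.

Lemma expected_payoff_perm d (f : 'I_N -> 'I_N) : injective f ->
  (forall i, share g (f i) = share g i) ->
  expected_payoff (fun i => d (f i)) = expected_payoff d.
Proof.
move=> finj sf; congr Rintegral; apply/funext => e; congr (nu g _).
rewrite /mass [RHS](reindex_inj finj) /=; apply: eq_bigr => i _.
by rewrite sf.
Qed.

Lemma le_expected_payoff d d' : (forall i, d i <= d' i) ->
  expected_payoff d <= expected_payoff d'.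
Proof.
move=> dd'; apply: (le_Rintegral measurableT) => [||e _]; [exact: integrable_turnout..|].
by apply: le_nu_mass => i /le_trans; apply.
Qed.

Let Rintegral_turnoutD d (c : R) (w : 'I_N -> R) d' :
  P.-integrable setT (EFin \o (fun e => turnout_payoff d e + step c w d' e)) /\
  (\int[P]_e (turnout_payoff d e + step c w d' e)) =
    expected_payoff d + (c + \sum_i w i * cdf (d' i)).
Proof.
have i1 := integrable_turnout d; have i2 := integrable_step c w d'.
split; last by rewrite RintegralD // Rintegral_step.
exact: (integrableD measurableT i1 i2).
Qed.

(** At shocks in []d j, d' j]] type [j] is gained, which is worth at least [k]; the last two bounds
    give these shocks positive probability. *)
Lemma lt_expected_payoff d d' j : (forall i, d i <= d' i) ->
  d j < d' j -> d j < phi g -> - phi g < d' j ->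
  expected_payoff d < expected_payoff d'.
Proof.
move=> dd' ddj djphi djphi'; have [k k0 kP] := nu_mass_gap j.
(* Weights on [j] alone express [k] times the indicator of a ray as a [step]. *)
pose w (c : R) i : R := if i == j then c else 0.
have wE c (t : 'I_N -> R) : \sum_i w c i * t i = c * t j.
  rewrite (bigD1 j) //= /w eqxx big1 ?addr0//.
  by move=> i /negbTE ->; rewrite mul0r.
have [i1 E1] := Rintegral_turnoutD d 0 (w k) d'.
have [i2 E2] := Rintegral_turnoutD d' 0 (w k) d.
have cdf_lt : k * cdf (d j) < k * cdf (d' j).
  by rewrite ltr_pM2l // uniform_cdf_lt ?phi_gt0.
have : expected_payoff d + (0 + \sum_i w k i * cdf (d' i)) <=
    expected_payoff d' + (0 + \sum_i w k i * cdf (d i)).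
  rewrite -E1 -E2; apply: le_Rintegral => // e _.
  rewrite /step !add0r !wE /turnout_payoff.
  have := @le_nu_mass (fun i => e <= d i) (fun i => e <= d' i)
    (fun i ei => le_trans ei (dd' i)).
  have [edj|edj] := boolP (e <= d j); first by rewrite (le_trans edj) //; lra.
  have [edj'|edj'] := boolP (e <= d' j); last by rewrite !mulr0; lra.
  have := kP (fun i => e <= d i) (fun i => e <= d' i)
    (fun i ei => le_trans ei (dd' i)) edj edj'.
  by rewrite /=; lra.
by rewrite !wE; lra.
Qed.

(** Jumps of [nu] are harmless: its range on electorates has length at most 1, so at each shock the
    loss is at most the number of types that vote for the party under [d] but not under [d']. The
    maximum [m] lets a sum of indicators count them. *)
Lemma expected_payoff_lip d d' :
  expected_payoff d - expected_payoff d' <= (\sum_i `|d i - d' i|) / (2 * phi g).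
Proof.
pose m i := Num.max (d i) (d' i).
have [i1 E1] := Rintegral_turnoutD d 0 (fun=> 1) d'.
have [i2 E2] := Rintegral_turnoutD d' 0 (fun=> 1) m.
have : expected_payoff d + (0 + \sum_i 1 * cdf (d' i)) <=
    expected_payoff d' + (0 + \sum_i 1 * cdf (m i)).
  rewrite -E1 -E2; apply: le_Rintegral => // e _; rewrite /step !add0r.
  have dm i : e <= d' i -> e <= m i by move=> h; rewrite le_max h orbT.
  have [/existsP[i /andP[ed ed']]|] := boolP [exists i, (e <= d i) && ~~ (e <= d' i)].
    have /andP[_ h1] := nu_mass_bounds (fun i => e <= d i).
    have /andP[h2 _] := nu_mass_bounds (fun i => e <= d' i).
    rewrite (bigD1 i) //= [in leRHS](bigD1 i) //= (negbTE ed') mulr0 add0r.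
    rewrite le_max ed mulr1.
    have : \sum_(l < N | l != i) 1 * (e <= d' l)%R%:R <=
        \sum_(l < N | l != i) 1 * (e <= m l)%R%:R :> R.
      apply: ler_sum => l _; rewrite !mul1r ler_nat; have := dm l.
      by case: (e <= d' l) => // ->.
    by move: h1 h2; rewrite /turnout_payoff; lra.
  rewrite negb_exists => /forallP h; apply: lerD.
    apply: le_nu_mass => i ei; move: (h i); rewrite ei /=.
    by rewrite negbK.
  apply: ler_sum => l _; rewrite !mul1r ler_nat; have := dm l.
  by case: (e <= d' l) => // ->.
have -> : (\sum_i `|d i - d' i|) / (2 * phi g) = \sum_i `|d i - d' i| / (2 * phi g).
  by rewrite mulr_suml.
have : \sum_i 1 * cdf (m i) - \sum_i 1 * cdf (d' i) <=
    \sum_i `|d i - d' i| / (2 * phi g).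
  rewrite -sumrB; apply: ler_sum => i _; rewrite !mul1r.
  have dm : d' i <= m i by rewrite le_max lexx orbT.
  apply: (le_trans (uniform_cdf_lip (phi_gt0 g) dm)).
  rewrite ler_pM2r ?invr_gt0 ?mulr_gt0 ?phi_gt0 // /m.
  case: (leP (d i) (d' i)) => h; first by rewrite subrr.
  exact: ler_norm.
by lra.
Qed.

End Payoffs.

(** * Equilibria and the potential *)

(* Locked: [payoff a b] and [payoff b a] are expensive to tell apart by
   conversion. *)
HB.lock Definition payoff (R : realType) (K N : nat) (g : platform_game R K N)
    (a b : 'rV[R]_K) : R :=
  expected_payoff g (fun i => Delta g i (a, b)).

Section Geometry.
Variables (R : realType) (K N : nat) (g : platform_game R K N).
Implicit Types (a b : 'rV[R]_K) (z : profile R K).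

Notation x := (bliss g).
Notation mu := (center g).
Notation lo k := (inf (range (fun i => x i 0 k))).
Notation hi k := (sup (range (fun i => x i 0 k))).

Notation payoff := (payoff g).

Lemma payoffE a b : payoff a b = expected_payoff g (fun i => Delta g i (a, b)).
Proof. by rewrite payoff.unlock. Qed.

Lemma enorm_sq (v : 'rV[R]_K) : enorm v ^+ 2 = \sum_k v 0 k ^+ 2.
Proof. by rewrite sqr_sqrtr // sumr_ge0 // => k _; rewrite sqr_ge0. Qed.

Lemma DeltaE i a b :
  Delta g i (a, b) = \sum_k ((b 0 k - x i 0 k) ^+ 2 - (a 0 k - x i 0 k) ^+ 2).
Proof.
rewrite /Delta /utility_gap !enorm_sq -sumrB.
by apply: eq_bigr => k _; rewrite !mxE.
Qed.

Lemma Delta_swap i a b : Delta g i (b, a) = - Delta g i (a, b).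
Proof. by rewrite /Delta /utility_gap opprB. Qed.

(** The tie rule favours A, but reversing the shock removes the asymmetry in expectation, so one
    function serves both parties. *)
Lemma V_own p z : V g p z = payoff (own p z) (opp p z).
Proof.
case: p; case: z => a b; rewrite /V expectation.unlock payoffE //=; last first.
have -> : (fun i => Delta g i (b, a)) = (fun i => - Delta g i (a, b)).
  by apply/funext => i; rewrite Delta_swap.
by rewrite -expected_payoff_opponent.
Qed.

Lemma V_play p a b : V g p (play p a b) = payoff a b.
Proof. by rewrite V_own; case: p. Qed.

Lemma bliss_bounds i k : lo k <= x i 0 k <= hi k.
Proof.
have bnd j : `|x j 0 k| <= \sum_l `|x l 0 k|.
  by rewrite (bigD1 j) //= lerDl sumr_ge0.
apply/andP; split.
  apply: ge_inf; last by exists i.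
  exists (- \sum_l `|x l 0 k|) => _ [j _ <-].
  by rewrite lerNl (le_trans _ (bnd j)) // -normrN ler_norm.
apply: ub_le_sup; last by exists i.
by exists (\sum_l `|x l 0 k|) => _ [j _ <-]; rewrite (le_trans (ler_norm _)).
Qed.

Lemma bounds_le k : lo k <= hi k.
Proof.
have /andP[h1 h2] := bliss_bounds (Ordinal (ltnW (types_ge2 g))) k.
exact: le_trans h1 h2.
Qed.

Definition barycenter (w : 'I_N -> R) : 'rV[R]_K := \sum_i w i *: x i.

Lemma D_barycenter w : (forall i, 0 <= w i) -> \sum_i w i = 1 -> D g (barycenter w).
Proof.
move=> w0 w1 k; rewrite summxE.
rewrite -[lo k]mul1r -[hi k]mul1r -w1 !mulr_suml.
by apply/andP; split; apply: ler_sum => i _; rewrite mxE ler_wpM2l //;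
  have /andP[] := bliss_bounds i k.
Qed.

Lemma Delta_lt_phi i a b : D g a -> D g b -> `|Delta g i (a, b)| < phi g.
Proof.
move=> Da Db; rewrite -lte_fin; apply: le_lt_trans (wide_support g).
apply: ereal_sup_ubound; exists i => //.
by exists (a, b).
Qed.

(** The nearest-point projection onto the box. *)
Definition clip a : 'rV[R]_K := \row_k Num.max (lo k) (Num.min (hi k) (a 0 k)).

Lemma D_clip a : D g (clip a).
Proof.
by move=> k; rewrite mxE le_max lexx /= ge_max bounds_le ge_min lexx.
Qed.

Lemma clip_closer (l h c y : R) : l <= y <= h ->
  (Num.max l (Num.min h c) - y) ^+ 2 <= (c - y) ^+ 2.
Proof.
move=> /andP[ly yh]; case: (leP h c) => hc; case: (leP l _) => lc; nra.
Qed.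

Lemma clip_closer_lt (l h c y : R) : l <= y <= h -> ~~ (l <= c <= h) ->
  (Num.max l (Num.min h c) - y) ^+ 2 < (c - y) ^+ 2.
Proof.
move=> /andP[ly yh]; rewrite negb_and -!ltNge => /orP hlc.
by case: (leP h c) => hc; case: (leP l _) => lc; case: hlc => ?; nra.
Qed.

Lemma Delta_clip i a b : Delta g i (a, b) <= Delta g i (clip a, b).
Proof.
rewrite !DeltaE; apply: ler_sum => k _; rewrite lerD2l lerN2 mxE.
by apply: clip_closer; exact: bliss_bounds.
Qed.

Lemma Delta_clip_lt i a b : ~ D g a -> Delta g i (a, b) < Delta g i (clip a, b).
Proof.
move=> /existsNP[k /negP nk]; rewrite !DeltaE (bigD1 k) //= [ltRHS](bigD1 k) //=.
apply: ltr_leD.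
  by rewrite ltrD2l ltrN2 mxE clip_closer_lt // bliss_bounds.
apply: ler_sum => l _; rewrite lerD2l lerN2 mxE.
by apply: clip_closer; exact: bliss_bounds.
Qed.

Lemma payoff_clip a b : payoff a b <= payoff (clip a) b.
Proof. by rewrite !payoffE; apply: le_expected_payoff => i; exact: Delta_clip. Qed.

Definition equilibrium a b :=
  (forall y, payoff y b <= payoff a b) /\ (forall y, payoff y a <= payoff b a).

Lemma nashE z : nash g z <-> equilibrium z.1 z.2.
Proof.
split=> [nz|[nA nB] p y].
  by split=> y; [have := nz PartyA y|have := nz PartyB y]; rewrite V_play V_own.
by rewrite V_play V_own; case: p; [exact: nA|exact: nB].
Qed.

Lemma equilibrium_sym a b : equilibrium a b -> equilibrium b a.
Proof. by case. Qed.

Notation cdf := (uniform_cdf (phi g)).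

Lemma payoff_weights a b :
  exists2 w, representing_weights g (fun i => Delta g i (a, b)) w &
    payoff a b = nu g 0 + \sum_i w i * cdf (Delta g i (a, b)).
Proof.
have [w wP] := representing_weights_ex g (fun i => Delta g i (a, b)).
by exists w => //; rewrite payoffE; exact: expected_payoffE.
Qed.

(** If [a] is outside the box, clipping raises every gap, a strict gain unless all gaps are at least
    [phi]. In that case the opponent gets only [nu 0] and gains at least one half by moving to
    [clip a]. *)
Lemma equilibrium_D a b : equilibrium a b -> D g a.
Proof.
move=> [nA nB]; apply: contrapT => nDa.
have [[i lti]|] := pselect (exists i, Delta g i (a, b) < phi g).
  have := nA (clip a); apply/negP; rewrite -ltNge !payoffE.
  apply: (lt_expected_payoff (j := i)) => // [l||].
  - exact: Delta_clip.
  - exact: Delta_clip_lt.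
  (* Clipping [b] can only lower the gap, so the bound for two platforms in the box carries over. *)
  have := Delta_lt_phi i (D_clip a) (D_clip b).
  rewrite ltr_norml => /andP[+ _] => /lt_le_trans; apply.
  by rewrite -[leRHS]opprK -Delta_swap -[leLHS]opprK -Delta_swap lerN2 Delta_clip.
move=> /forallNP all_ge.
have [w [w0 w1 _ _] E] := payoff_weights b a.
have [w' [w'0 w'1 _ _] E'] := payoff_weights (clip a) a.
have S0 : \sum_i w i * cdf (Delta g i (b, a)) = 0.
  apply: big1 => i _; rewrite uniform_cdf_out ?mulr0 ?phi_gt0 //.
  by rewrite Delta_swap lerN2 leNgt; apply/negP; exact: all_ge.
have := nB (clip a); rewrite E E' lerD2l S0.
apply/negP; rewrite -ltNge; apply: (@lt_le_trans _ _ 2^-1); first by rewrite invr_gt0.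
have <- : \sum_i w' i * 2^-1 = 2^-1 by rewrite -mulr_suml w'1 mul1r.
apply: ler_sum => i _.
rewrite ler_pM2l ?w'0 // uniform_cdf_ge_half ?phi_gt0 //.
by apply: le_trans (Delta_clip i a a); rewrite /Delta /utility_gap subrr.
Qed.

(** * Central symmetry and the exact potential *)

Lemma reflection_ex : exists f : 'I_N -> 'I_N,
  [/\ injective f, forall i, share g (f i) = share g i &
      forall i, x (f i) = 2 *: mu - x i].
Proof.
have [f fP] := choice (central_symmetry g).
exists f; split=> [i j fij|i|i]; [|by have [] := fP i|by have [] := fP i].
apply: (@bliss_inj _ _ _ g); have [fi _] := fP i; have [fj _] := fP j.
by move: fi; rewrite fij fj => /addrI/oppr_inj.
Qed.

Lemma Delta_reflected i j a b : x j = 2 *: mu - x i ->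
  Delta g j (a, b) = 2 * (enorm (b - mu) ^+ 2 - enorm (a - mu) ^+ 2) - Delta g i (a, b).
Proof.
move=> xj; rewrite !DeltaE !enorm_sq -sumrB mulr_sumr -sumrB.
by apply: eq_bigr => k _; rewrite xj !mxE; ring.
Qed.

Lemma payoff_in_D a b w : D g a -> D g b ->
  nu g 0 + \sum_i w i * cdf (Delta g i (a, b)) =
  nu g 0 + (\sum_i w i) / 2 + (\sum_i w i * Delta g i (a, b)) / (2 * phi g).
Proof.
move=> Da Db; rewrite -addrA; congr (_ + _); rewrite !mulr_suml -big_split.
apply: eq_bigr => i _; rewrite /= uniform_cdf_in ?phi_gt0 //.
  by rewrite mulrDr mulrA.
by have := Delta_lt_phi i Da Db; rewrite ltr_norml => /andP[h1 h2]; rewrite !ltW.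
Qed.

(** Up to the reflection of types, swapping the platforms translates all gaps by [- 2 * c]. The same
    weights then apply, and the distribution function is affine at the gaps involved. *)
Lemma payoff_difference a b : D g a -> D g b ->
  payoff a b - payoff b a = (enorm (b - mu) ^+ 2 - enorm (a - mu) ^+ 2) / phi g.
Proof.
move=> Da Db; have [w wP E] := payoff_weights a b.
have [f [finj fs fx]] := reflection_ex; have [_ w1 _ _] := wP.
set c := enorm (b - mu) ^+ 2 - enorm (a - mu) ^+ 2.
have dE i : Delta g i (b, a) = Delta g (f i) (a, b) - 2 * c.
  by rewrite Delta_swap (Delta_reflected _ _ (fx i)) -/c; lra.
have -> : payoff b a = expected_payoff g (fun i => Delta g i (a, b) - 2 * c).
  rewrite payoffE -[RHS](expected_payoff_perm _ finj fs); congr expected_payoff.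
  by apply/funext => i; rewrite dE.
rewrite (expected_payoff_shift (2 * c) wP) E payoff_in_D // w1.
have -> : \sum_i w i * uniform_cdf (phi g) (Delta g i (a, b) - 2 * c) =
    1 / 2 + (\sum_i w i * Delta g i (a, b)) / (2 * phi g) - 2 * c / (2 * phi g).
  rewrite (eq_bigr (fun i => w i * 2^-1 + w i * Delta g i (a, b) * (2 * phi g)^-1 -
      w i * (2 * c / (2 * phi g)))) => [|i _].
    by rewrite sumrB big_split /= -!mulr_suml w1 !mul1r.
  rewrite uniform_cdf_in ?phi_gt0 //; first by field; rewrite gt_eqF ?phi_gt0.
  (* The translated gap is minus the gap of the reflected type, so wide support covers it. *)
  have := Delta_lt_phi (f i) Da Db; rewrite (Delta_reflected _ _ (fx i)) -/c.
  by rewrite ltr_norml => /andP[h1 h2]; apply/andP; split; lra.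
by field; rewrite gt_eqF ?phi_gt0.
Qed.

Lemma PhiE a b : Phi g (a, b) = payoff a b - enorm (b - mu) ^+ 2 / phi g.
Proof. by rewrite /Phi V_own. Qed.

(** Together with [PhiE]: for each party, [Phi] is its payoff minus a term in the opponent's
    platform only. *)
Lemma Phi_payoffB a b : D g a -> D g b ->
  Phi g (a, b) = payoff b a - enorm (a - mu) ^+ 2 / phi g.
Proof.
move=> Da Db; rewrite PhiE -[payoff a b](subrK (payoff b a)) payoff_difference // mulrBl.
move: (payoff b a) (_ ^+ 2 / _) (_ ^+ 2 / _) => u v w; ring.
Qed.

Lemma argmax_Phi_equilibrium a b : argmax (D g `*` D g) (Phi g) (a, b) -> equilibrium a b.
Proof.
move=> [[/= Da Db] Pmax]; split=> y; apply: le_trans (payoff_clip _ _) _.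
  by have := Pmax (clip y, b) (conj (D_clip y) Db); rewrite !PhiE lerD2r.
have := Pmax (a, clip y) (conj Da (D_clip y)).
by rewrite !Phi_payoffB ?lerD2r //; exact: D_clip.
Qed.

End Geometry.

(** * Equilibrium payoffs and limits of grid maximizers *)

Section Equilibria.
Variables (R : realType) (K N : nat) (g : platform_game R K N).
Implicit Types (a b : 'rV[R]_K) (z : profile R K).

Notation x := (bliss g).
Notation mu := (center g).
Notation payoff := (payoff g).
Notation cdf := (uniform_cdf (phi g)).

(* [w] defines a minorant of the payoff, affine in the utility gaps as long as
   these stay in the support of the shock, which is exact at [(a, b)]. *)
Definition supporting_weights a b (w : 'I_N -> R) :=
  [/\ forall i, 0 <= w i, \sum_i w i = 1,
      payoff a b = nu g 0 + \sum_i w i * cdf (Delta g i (a, b)) &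
      forall a' b', nu g 0 + \sum_i w i * cdf (Delta g i (a', b')) <= payoff a' b'].

Lemma supporting_weights_ex a b : decreasing_increments (nu g) ->
  exists w, supporting_weights a b w.
Proof.
move=> dec; have [w wP E] := payoff_weights g a b; have [w0 w1 _ _] := wP.
exists w; split=> // [i|a' b']; first exact: ltW.
by rewrite payoffE; exact: le_expected_payoff_concave wP.
Qed.

(** Huygens identity: the spread of the bliss points about their barycenter cancels between the two
    platforms. *)
Lemma sum_weighted_Delta w a b : \sum_i w i = 1 ->
  \sum_i w i * Delta g i (a, b) =
  enorm (b - barycenter g w) ^+ 2 - enorm (a - barycenter g w) ^+ 2.
Proof.
move=> w1; rewrite !enorm_sq -sumrB.
under eq_bigr do rewrite DeltaE mulr_sumr.
rewrite exchange_big /=; apply: eq_bigr => k _; rewrite !mxE !summxE.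
set m := \sum_i (w i *: x i) 0 k.
have E i : w i * ((b 0 k - x i 0 k) ^+ 2 - (a 0 k - x i 0 k) ^+ 2) =
    w i * (b 0 k ^+ 2 - a 0 k ^+ 2) - (w i *: x i) 0 k * (2 * (b 0 k - a 0 k)).
  by rewrite mxE; ring.
under eq_bigr do rewrite E.
by rewrite sumrB -!mulr_suml w1 -/m; ring.
Qed.

Lemma supporting_payoff a b w : D g a -> D g b -> \sum_i w i = 1 ->
  nu g 0 + \sum_i w i * cdf (Delta g i (a, b)) = nu g 0 + 1 / 2 +
    (enorm (b - barycenter g w) ^+ 2 - enorm (a - barycenter g w) ^+ 2) / (2 * phi g).
Proof. by move=> Da Db w1; rewrite payoff_in_D // w1 sum_weighted_Delta. Qed.

Lemma enorm0 : enorm (0 : 'rV[R]_K) = 0.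
Proof. by rewrite /enorm big1 ?sqrtr0 // => k _; rewrite mxE expr0n. Qed.

Lemma enorm_sq_le0 (v : 'rV[R]_K) : enorm v ^+ 2 <= 0 -> v = 0.
Proof.
rewrite enorm_sq => v0; apply/rowP => k; rewrite mxE; apply/eqP.
have s0 (l : 'I_K) : true -> 0 <= v 0 l ^+ 2 by rewrite sqr_ge0.
have /eqP : \sum_l v 0 l ^+ 2 = 0 by apply: le_anti; rewrite v0 sumr_ge0.
by rewrite psumr_eq0 // => /allP/(_ k (mem_index_enum _)); rewrite sqrf_eq0.
Qed.

(** The minorant is exact at [a] and, on the box, peaks only at the barycenter in the own platform;
    otherwise moving there would pay. *)
Lemma best_reply_barycenter a b w : D g a -> D g b -> supporting_weights a b w ->
  (forall y, payoff y b <= payoff a b) -> a = barycenter g w.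
Proof.
move=> Da Db [w0 w1 E minor] best; set m := barycenter g w.
have Dm : D g m by exact: D_barycenter.
have := le_trans (minor m b) (best m).
rewrite E !supporting_payoff // -/m subrr enorm0 lerD2l.
rewrite ler_pM2r ?invr_gt0 ?mulr_gt0 ?phi_gt0 // lerD2l lerN2 expr0n /=.
by move=> /enorm_sq_le0/eqP; rewrite subr_eq0 => /eqP.
Qed.

(** Exactness at the swapped profile comes from [payoff_difference]; the minorant comes from
    reflecting both platforms through [mu], which permutes the gaps. *)
Lemma supporting_weights_reflected a b w (f : 'I_N -> 'I_N) : D g a -> D g b ->
  injective f -> (forall i, share g (f i) = share g i) ->
  (forall i, x (f i) = 2 *: mu - x i) ->
  supporting_weights a b w -> supporting_weights b a (fun i => w (f i)).
Proof.
move=> Da Db finj fs fx [w0 w1 E minor].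
have wf1 : \sum_i w (f i) = 1 by rewrite -w1 [RHS](reindex_inj finj).
split=> // [|a' b'].
  set c := enorm (b - mu) ^+ 2 - enorm (a - mu) ^+ 2.
  have S : \sum_i w (f i) * Delta g i (b, a) = \sum_i w i * Delta g i (a, b) - 2 * c.
    rewrite -[2 * c]mul1r -[X in _ - X * _]wf1 mulr_suml.
    rewrite [X in _ = X - _](reindex_inj finj) /= -sumrB; apply: eq_bigr => i _.
    by rewrite (Delta_reflected _ _ (fx i)) -/c Delta_swap; ring.
  have := payoff_difference Da Db; rewrite -/c E !payoff_in_D // w1 wf1 S => D1.
  have -> : payoff b a = nu g 0 + 1 / 2 + (\sum_i w i * Delta g i (a, b)) / (2 * phi g)
      - c / phi g by rewrite -D1; ring.
  by field; rewrite gt_eqF ?phi_gt0.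
pose r v : 'rV[R]_K := 2 *: mu - v.
have rE i : Delta g (f i) (r a', r b') = Delta g i (a', b').
  by rewrite !DeltaE; apply: eq_bigr => k _; rewrite fx !mxE; ring.
have -> : payoff a' b' = payoff (r a') (r b').
  rewrite !payoffE -[RHS](expected_payoff_perm _ finj fs); congr expected_payoff.
  by apply/funext => i; rewrite rE.
have -> : \sum_i w (f i) * cdf (Delta g i (a', b')) =
    \sum_i w i * cdf (Delta g i (r a', r b')).
  by rewrite [RHS](reindex_inj finj) /=; apply: eq_bigr => i _; rewrite rE.
exact: minor.
Qed.

(* Both parties play barycenters for weights supporting the same profile, which
   forces platforms symmetric about the center. *)
Lemma equilibrium_payoff a b : decreasing_increments (nu g) -> equilibrium g a b ->
  a = 2 *: mu - b /\ payoff a b = nu g 0 + 1 / 2 + 2 * enorm (b - mu) ^+ 2 / phi g.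
Proof.
move=> dec eq_ab; have Da := equilibrium_D eq_ab.
have Db := equilibrium_D (equilibrium_sym eq_ab); have [nA nB] := eq_ab.
have [w wP] := supporting_weights_ex a b dec.
have [f [finj fs fx]] := reflection_ex g.
have aE := best_reply_barycenter Da Db wP nA.
have bE := best_reply_barycenter Db Da
  (supporting_weights_reflected Da Db finj fs fx wP) nB.
have [w0 w1 E _] := wP.
have abE : a = 2 *: mu - b.
  rewrite aE bE /barycenter [LHS](reindex_inj finj) /=.
  have -> : 2 *: mu = \sum_i w (f i) *: (2 *: mu).
    by rewrite -scaler_suml -[LHS]scale1r -w1 [X in X *: _ = _](reindex_inj finj).
  by rewrite -sumrB; apply: eq_bigr => i _; rewrite fx scalerBr.
split=> //; rewrite E supporting_payoff // -aE subrr enorm0.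
have -> : enorm (b - a) ^+ 2 = 4 * enorm (b - mu) ^+ 2.
  by rewrite !enorm_sq mulr_sumr; apply: eq_bigr => k _; rewrite abE !mxE; ring.
by field; rewrite gt_eqF ?phi_gt0.
Qed.

(** With [t] the common squared distance to [mu], payoffs are [nu 0 + 1 / 2 + 2 * t / phi], and
    [Phi] subtracts [t / phi]. *)
Lemma equilibrium_V p z : decreasing_increments (nu g) -> nash g z ->
  V g p z = 2 * Phi g z - (nu g 0 + 1 / 2).
Proof.
case: z => a b dec /nashE/= eq_ab.
have [abE E] := equilibrium_payoff dec eq_ab.
have [_ E'] := equilibrium_payoff dec (equilibrium_sym eq_ab).
have nE : enorm (a - mu) ^+ 2 = enorm (b - mu) ^+ 2.
  by rewrite !enorm_sq; apply: eq_bigr => k _; rewrite abE !mxE; ring.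
rewrite V_own PhiE E.
by case: p => /=; rewrite ?E ?E' ?nE; move: (_ ^+ 2) => t; field;
  rewrite gt_eqF ?phi_gt0.
Qed.

Lemma argmax_party_preferred z : decreasing_increments (nu g) ->
  argmax (D g `*` D g) (Phi g) z -> party_preferred g z.
Proof.
move=> dec zmax; have nz : nash g z.
  by apply/nashE; apply: argmax_Phi_equilibrium; case: z zmax.
split=> // p w nw; rewrite !equilibrium_V // lerD2r ler_pM2l //.
have /nashE ew := nw; apply: zmax.2; split; first exact: equilibrium_D ew.
exact: equilibrium_D (equilibrium_sym ew).
Qed.

(** * Continuity of the potential and refinement of the grids *)

Lemma coord_fst_continuous k : continuous (fun z : profile R K => z.1 0 k).
Proof.
move=> z; apply: (@continuous_comp _ _ _ fst (fun v : 'rV[R]_K => v 0 k)).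
  exact: cvg_fst.
exact: coord_continuous.
Qed.

Lemma coord_snd_continuous k : continuous (fun z : profile R K => z.2 0 k).
Proof.
move=> z; apply: (@continuous_comp _ _ _ snd (fun v : 'rV[R]_K => v 0 k)).
  exact: cvg_snd.
exact: coord_continuous.
Qed.

Lemma sum_continuous (T : topologicalType) (n : nat) (h : 'I_n -> T -> R) :
  (forall i, continuous (h i)) -> continuous (fun t => \sum_i h i t).
Proof.
move=> hc t; elim: (index_enum _) => [|i s IH].
  by under eq_fun do rewrite big_nil; exact: cst_continuous.
by under eq_fun do rewrite big_cons; apply: cvgD => //; exact: hc.
Qed.

Lemma Delta_continuous i : continuous (Delta g i).
Proof.
have -> : Delta g i = fun z : profile R K => \sum_k
    ((z.2 0 k - x i 0 k) * (z.2 0 k - x i 0 k) -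
     (z.1 0 k - x i 0 k) * (z.1 0 k - x i 0 k)).
  apply/funext => -[a b]; rewrite DeltaE.
  by apply: eq_bigr => k _; rewrite !expr2.
apply: sum_continuous => k z.
by apply: cvgB; apply: cvgM; apply: cvgB;
  [exact: coord_snd_continuous|exact: cvg_cst|exact: coord_snd_continuous|
   exact: cvg_cst|exact: coord_fst_continuous|exact: cvg_cst|
   exact: coord_fst_continuous|exact: cvg_cst].
Qed.

Lemma Phi_continuous : continuous (Phi g).
Proof.
have -> : Phi g = (fun z => payoff z.1 z.2 -
    (\sum_k (z.2 0 k - mu 0 k) * (z.2 0 k - mu 0 k)) / phi g).
  apply/funext => -[a b]; rewrite PhiE enorm_sq; congr (_ - _ / _).
  by apply: eq_bigr => k _; rewrite !mxE expr2.
move=> z; apply: cvgB; last first.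
  apply: cvgM; last exact: cvg_cst.
  apply: sum_continuous => k u; apply: cvgM; apply: cvgB; first 1 last.
  - exact: cvg_cst.
  - exact: coord_snd_continuous.
  - exact: cvg_cst.
  - exact: coord_snd_continuous.
(* The Lipschitz bound in the gaps squeezes the payoff between [payoff z.1 z.2 - h u] and
   [payoff z.1 z.2 + h u]. *)
pose h (u : profile R K) :=
  (\sum_i `|Delta g i u - Delta g i z|) / (2 * phi g).
have hc : h u @[u --> z] --> (0 : R).
  have -> : (0 : R) = h z.
    by rewrite /h big1 ?mul0r // => i _; rewrite subrr normr0.
  apply: cvgM; last exact: cvg_cst.
  apply: (@sum_continuous _ _ (fun i u => `|Delta g i u - Delta g i z|)) => i u.
  by apply: cvg_norm; apply: cvgB; [exact: Delta_continuous|exact: cvg_cst].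
have lip (u v : profile R K) : payoff u.1 u.2 - payoff v.1 v.2 <=
    (\sum_i `|Delta g i u - Delta g i v|) / (2 * phi g).
  case: u => a b; case: v => a' b'; rewrite !payoffE; exact: expected_payoff_lip.
apply: (squeeze_cvgr (f := fun u => payoff z.1 z.2 - h u)
   (h := fun u => payoff z.1 z.2 + h u)).
- apply: nearW => u; apply/andP; split; last by rewrite addrC -lerBlDr; exact: lip.
  rewrite lerBlDr addrC -lerBlDr (le_trans (lip z u)) // /h.
  by under eq_bigr do rewrite distrC.
- by rewrite -[X in _ --> X]subr0; apply: cvgB => //; exact: cvg_cst.
- by rewrite -[X in _ --> X]addr0; apply: cvgD => //; exact: cvg_cst.
Qed.

Lemma D_closed_cluster (F : set_system (profile R K)) z :
  F (D g `*` D g) -> cluster F z -> (D g `*` D g) z.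
Proof.
move=> FD zF.
have bound (h : profile R K -> R) (c : R) : continuous h ->
    (forall u, (D g `*` D g) u -> h u <= c) -> h z <= c.
  move=> hc hD; rewrite leNgt; apply/negP => ch.
  have [u [Du hu]] := zF _ _ FD (hc z _ (lt_nbhsr ch)).
  by move: hu; rewrite /= ltNge hD.
split=> k; apply/andP; split.
- rewrite -lerN2; apply: (bound (fun u => - u.1 0 k)) => [u|u [Du _]].
    by apply: cvgN; exact: coord_fst_continuous.
  by rewrite lerN2; have /andP[] := Du k.
- by apply: (bound (fun u => u.1 0 k)) => [|u [Du _]];
    [exact: coord_fst_continuous|have /andP[] := Du k].
- rewrite -lerN2; apply: (bound (fun u => - u.2 0 k)) => [u|u [_ Du]].
    by apply: cvgN; exact: coord_snd_continuous.
  by rewrite lerN2; have /andP[] := Du k.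
- by apply: (bound (fun u => u.2 0 k)) => [|u [_ Du]];
    [exact: coord_snd_continuous|have /andP[] := Du k].
Qed.

Lemma norm_le_enorm (v : 'rV[R]_K) : `|v| <= enorm v.
Proof.
rewrite [leLHS]mx_normrE; apply/bigmax_leP; split=> [|[i k] _]; first exact: sqrtr_ge0.
rewrite (ord1 i) /= -sqrtr_sqr ler_wsqrtr // (bigD1 k) //= lerDl.
by rewrite sumr_ge0 // => l _; rewrite sqr_ge0.
Qed.

Lemma mesh_approx (G : nat -> {fset 'rV[R]_K}) (v : 'rV[R]_K) (A : set 'rV[R]_K) :
  mesh g (G n) @[n --> \oo] --> 0%E -> D g v -> nbhs v A ->
  \forall n \near \oo, exists2 y, y \in G n & A y.
Proof.
move=> Gmesh Dv /nbhs_ballP[e /= e0 eA].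
have ne : nbhs (0 : \bar R)%E [set t | (t < e%:E)%E].
  by apply: open_nbhs_nbhs; split; [exact: open_ereal_lt_ereal|rewrite /= lte_fin].
have lt_e : \forall n \near \oo, (mesh g (G n) < e%:E)%E by exact: Gmesh ne.
near=> n; have meshe : (mesh g (G n) < e%:E)%E by near: n.
have : (ereal_inf [set (enorm (v - y))%:E | y in [set` G n]] < e%:E)%E.
  by apply: le_lt_trans meshe; apply: ereal_sup_ubound; exists v.
move=> /ereal_inf_lt[_ [y yG <-]]; rewrite lte_fin => vy; exists y => //.
by apply: eA; rewrite -ball_normE /=; exact: le_lt_trans (norm_le_enorm _) vy.
Unshelve. all: by end_near.
Qed.

(** If [(a, b)] did better than [z], fine grids would contain profiles near [(a, b)] above the
    midpoint value [c]. The maximizers would then stay above [c], while [Phi] is below [c] near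
    [z]. *)
Lemma cluster_grid_maximizers (G : nat -> {fset 'rV[R]_K}) (xs : forall n, G n * G n) z :
  (forall n, [set` G n] `<=` D g) ->
  mesh g (G n) @[n --> \oo] --> 0%E ->
  (forall n, xs n \in maximizers g (G n)) ->
  cluster ((fun n => emb (xs n)) @ \oo) z ->
  argmax (D g `*` D g) (Phi g) z.
Proof.
move=> GD Gmesh xsmax zcl.
have Dz : (D g `*` D g) z.
  have ev : \forall n \near \oo, (D g `*` D g) (emb (xs n)).
    by apply: nearW => n; split; apply: (GD n); exact: fsvalP.
  exact: D_closed_cluster ev zcl.
split=> // -[a b] [/= Da Db]; rewrite leNgt; apply/negP => zab.
pose c := (Phi g z + Phi g (a, b)) / 2.
have [zc cab] : Phi g z < c /\ c < Phi g (a, b).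
  by rewrite /c; move: (Phi g z) (Phi g (a, b)) zab => u v; split; lra.
have [[A B] /= [nA nB] AB] := Phi_continuous (lt_nbhsr cab).
have ev : \forall n \near \oo, c < Phi g (emb (xs n)).
  near=> n.
  have [y yG Ay] : exists2 y, y \in G n & A y by near: n; exact: mesh_approx nA.
  have [y' yG' By'] : exists2 y, y \in G n & B y by near: n; exact: mesh_approx nB.
  have := xsmax n; rewrite finset.inE => /forallP/(_ (FSetSub yG, FSetSub yG')).
  by apply: lt_le_trans; exact: (AB (y, y')).
have [u [cu uc]] := zcl [set u | c < Phi g u] _ ev (Phi_continuous (lt_nbhsl zc)).
by move: (lt_trans cu uc); rewrite ltxx.
Unshelve. all: by end_near.
Qed.

End Equilibria.

(** * The logit process and its stationary distribution *)

Section StationaryUniqueness.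
Variables (R : realType) (S : finType) (P : S -> S -> R).
Hypothesis P_ge0 : forall z w, 0 <= P z w.
Hypothesis P_two_steps : forall z w, exists2 u, 0 < P z u & 0 < P u w.

(* Subtracting from [q] the largest multiple of [p] below it leaves an invariant
   measure with a zero, and zeros propagate backwards along transitions. *)
Lemma stationary_unique (p q : S -> R) : (forall z, 0 < p z) ->
  stationary P p -> stationary P q -> p = q.
Proof.
move=> p_gt0 [_ p1 pP] [q_ge0 q1 qP].
have [z1 _] : exists z1 : S, z1 \in index_enum S.
  case E : (index_enum S) => [|z1 s]; last by exists z1; rewrite in_cons eqxx.
  by move: p1; rewrite E big_nil => /esym/eqP; rewrite oner_eq0.
case: (@arg_minP _ _ _ z1 predT (fun z => q z / p z) isT) => z0 _ min_z0.
set m := q z0 / p z0; pose u z := q z - m * p z.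
have u_ge0 z : 0 <= u z by rewrite subr_ge0 -ler_pdivlMr // min_z0.
have uP w : \sum_z u z * P z w = u w.
  rewrite /u -pP -qP mulr_sumr -sumrB; apply: eq_bigr => z _.
  by rewrite mulrBl mulrA.
have back z w : 0 < P z w -> u w = 0 -> u z = 0.
  move=> Pzw uw0; have := uP w; rewrite uw0 => /eqP.
  rewrite psumr_eq0 => [|y _]; last exact: mulr_ge0.
  by move=> /allP/(_ z (mem_index_enum _)); rewrite mulf_eq0 (gt_eqF Pzw) orbF => /eqP.
have u0 z : u z = 0.
  have [y Pzy Pyz0] := P_two_steps z z0.
  by apply: back Pzy (back _ _ Pyz0 _); rewrite /u /m divfK ?subrr // gt_eqF.
have qE z : q z = m * p z by have := u0 z; rewrite /u => /subr0_eq.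
have m1 : m = 1.
  by move: q1; under eq_bigr do rewrite qE; rewrite -mulr_sumr p1 mulr1.
by apply/funext => z; rewrite qE m1 mul1r.
Qed.

End StationaryUniqueness.

(** * The limit of Gibbs measures at vanishing noise *)

Lemma expR_div_cvg0 (R : realType) (c : R) : c < 0 ->
  expR (c / t) @[t --> 0^'+] --> (0 : R).
Proof.
move=> c0; have nc0 : 0 < - c by rewrite oppr_gt0.
(* The upper bound comes from [1 + u <= expR u] at [u = - c / t]. *)
apply: (squeeze_cvgr (f := fun=> 0) (h := fun t => t * (- c)^-1)).
- near=> t; have t0 : 0 < t by near: t; exact: nbhs_right_gt.
  have ct : 0 < - c / t by rewrite divr_gt0.
  have -> : t * (- c)^-1 = (- c / t)^-1 by rewrite invfM invrK mulrC.
  rewrite expR_ge0 /= -[c / t]opprK expRN -mulNr lef_pV2 ?posrE ?expR_gt0 //.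
  by apply: le_trans (expR_ge1Dx _); rewrite lerDr.
- exact: cvg_cst.
- rewrite -[X in _ --> X](mul0r (- c)^-1); apply: cvgM; last exact: cvg_cst.
  exact: cvg_at_right_filter cvg_id.
Unshelve. all: by end_near.
Qed.

Section GibbsLimits.
Variables (R : realType) (S : finType) (F : S -> R).

Let gibbs_measure (t : R) z := expR (F z / t) / \sum_y expR (F y / t).

Let argmaxF := [set z | [forall w, F w <= F z]]%SET.

Lemma gibbs_measure_cvg z :
  gibbs_measure t z @[t --> 0^'+] --> ((z \in argmaxF)%:R / #|argmaxF|%:R : R).
Proof.
case: (@arg_maxP _ _ _ z predT F isT) => zm _ max_zm'.
have max_zm w : F w <= F zm by exact: max_zm'.
have in_max y : (y \in argmaxF) = (F y == F zm).
  rewrite finset.inE; apply/forallP/eqP => [h|-> w]; last exact: max_zm.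
  by apply/eqP; rewrite eq_le max_zm // h.
(* After division by the largest exponential, each term tends to 1 on the argmax and to 0
   elsewhere. *)
have gE : gibbs_measure ^~ z = fun t => expR ((F z - F zm) / t) *
    (\sum_y expR ((F y - F zm) / t))^-1.
  apply/funext => t; rewrite /gibbs_measure.
  have shift y : expR ((F y - F zm) / t) = expR (F y / t) * expR (- F zm / t).
    by rewrite mulrDl expRD.
  under [in RHS]eq_bigr do rewrite shift.
  by rewrite shift -mulr_suml invfM mulrACA divff ?mulr1 // gt_eqF ?expR_gt0.
have term y : expR ((F y - F zm) / t) @[t --> 0^'+] --> ((y \in argmaxF)%:R : R).
  rewrite in_max; have [->|neq] := eqVneq (F y) (F zm).
    by under eq_fun do rewrite subrr mul0r expR0; exact: cvg_cst.
  by apply: expR_div_cvg0; rewrite subr_lt0 lt_neqAle neq max_zm.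
rewrite gE; apply: cvgM; first exact: term.
have card : \sum_y (y \in argmaxF)%:R = #|argmaxF|%:R :> R.
  by rewrite -sum1_card natr_sum [RHS]big_mkcond; apply: eq_bigr => y _; case: ifP.
apply: cvgV.
  rewrite pnatr_eq0 -lt0n card_gt0; apply/set0Pn; exists zm.
  by rewrite in_max.
rewrite -card; elim: (index_enum S) => [|y s IH].
  by under eq_fun do rewrite big_nil; rewrite big_nil; exact: cvg_cst.
under eq_fun do rewrite big_cons; rewrite big_cons; exact: cvgD.
Qed.

End GibbsLimits.

(** * Invariance and uniqueness of the Gibbs measure *)

Section LogitProcess.
Variables (R : realType) (K N : nat) (g : platform_game R K N).
Variables (G : {fset 'rV[R]_K}) (chi : party -> R) (tau : R).
Hypothesis GD : [set` G] `<=` D g.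
Hypothesis chi_gt0 : forall p, 0 < chi p.
Hypothesis chi_sum1 : chi PartyA + chi PartyB = 1.

Let E (z : G * G) := expR (Phi g (emb z) / tau).

Lemma sum_expR_gt0 (T : finType) (F : T -> R) (y : T) : 0 < \sum_z expR (F z).
Proof.
by rewrite (bigD1 y) //= ltr_pwDl ?expR_gt0 // sumr_ge0 // => z _; exact: expR_ge0.
Qed.

(** Payoff and potential differ by a constant [c] depending on [o] only, which cancels in the
    quotient. *)
Lemma logit_potential p (y o : G) :
  logit g p tau y o = E (play p y o) / \sum_z E (play p z o).
Proof.
have DG (u : G) : D g (fsval u) by apply: GD; exact: fsvalP.
have [c cP] : exists c, forall u : G, V g p (emb (play p u o)) =
    Phi g (emb (play p u o)) + c.
  exists (enorm (fsval o - center g) ^+ 2 / phi g) => u.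
  rewrite V_own /emb; case: p => /=; first by rewrite PhiE subrK.
  by rewrite Phi_payoffB ?subrK //; exact: DG.
have shift u : expR (V g p (emb (play p u o)) / tau) = E (play p u o) * expR (c / tau).
  by rewrite cP mulrDl expRD.
rewrite /logit; under eq_bigr do rewrite shift.
by rewrite shift -mulr_suml invfM mulrACA divff ?mulr1 // gt_eqF ?expR_gt0.
Qed.

Lemma logit_gt0 p (y o : G) : 0 < logit g p tau y o.
Proof. by rewrite divr_gt0 ?expR_gt0 ?(sum_expR_gt0 _ y). Qed.

Lemma gibbs_gt0 (z : G * G) : 0 < gibbs g tau z.
Proof. by rewrite divr_gt0 ?expR_gt0 ?(sum_expR_gt0 _ z). Qed.

Lemma revision_ge0 (z w : G * G) : 0 <= revision g chi tau z w.
Proof.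
by rewrite addr_ge0 // mulr_ge0 ?(ltW (chi_gt0 _)) // mulr_ge0 ?(ltW (logit_gt0 _ _ _)).
Qed.

Lemma revision_gt0 p (z w : G * G) : opp p w = opp p z -> 0 < revision g chi tau z w.
Proof.
have pos q (y o : G) : 0 < chi q * (logit g q tau y o * 1).
  by rewrite mulr1 mulr_gt0 ?logit_gt0.
have nneg q (y o : G) (b : bool) : 0 <= chi q * (logit g q tau y o * b%:R).
  by rewrite mulr_ge0 ?(ltW (chi_gt0 _)) // mulr_ge0 ?(ltW (logit_gt0 _ _ _)).
rewrite /revision; case: p => /= ->; rewrite eqxx.
  exact: ltr_pwDl (pos _ _ _) (nneg _ _ _ _).
exact: ltr_wpDl (nneg _ _ _ _) (pos _ _ _).
Qed.

Lemma gibbs_stationary : G != fset0 ->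
  stationary (@revision _ _ _ g G chi tau) (gibbs g tau).
Proof.
move=> /fset0Pn[y0 y0G]; pose z0 := (FSetSub y0G, FSetSub y0G).
have Zn0 : \sum_z E z != 0 by rewrite gt_eqF ?(sum_expR_gt0 _ z0).
have row_n0 p (y o : G) : \sum_z E (play p z o) != 0.
  by rewrite gt_eqF ?(sum_expR_gt0 _ y).
split=> [z||w]; [exact: ltW (gibbs_gt0 z)|by rewrite -mulr_suml divff|].
(* A's choice has the Gibbs conditional law given [w.2]: the total mass of that slice times the
   conditional probability of [w.1] returns the mass of [w]. *)
have stepA : \sum_z gibbs g tau z * (logit g PartyA tau w.1 z.2 * (w.2 == z.2)%:R) =
    gibbs g tau w.
  rewrite -(pair_bigA _ (fun i j => gibbs g tau (i, j) *
    (logit g PartyA tau w.1 j * (w.2 == j)%:R))) /=.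
  under eq_bigr => i _.
    rewrite (bigD1 w.2) //= eqxx big1 => [|j /negbTE jw]; last first.
      by rewrite eq_sym jw !mulr0.
    rewrite addr0 mulr1 mulrC /gibbs.
    over.
  rewrite /= -mulr_sumr -mulr_suml logit_potential /gibbs /= -/(E w).
  by rewrite mulrA divfK ?(row_n0 PartyA w.1) //.
have stepB : \sum_z gibbs g tau z * (logit g PartyB tau w.2 z.1 * (w.1 == z.1)%:R) =
    gibbs g tau w.
  rewrite -(pair_bigA _ (fun i j => gibbs g tau (i, j) *
    (logit g PartyB tau w.2 i * (w.1 == i)%:R))) /= exchange_big /=.
  under eq_bigr => i _.
    rewrite (bigD1 w.1) //= eqxx big1 => [|j /negbTE jw]; last first.
      by rewrite eq_sym jw !mulr0.
    rewrite addr0 mulr1 mulrC /gibbs.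
    over.
  rewrite /= -mulr_sumr -mulr_suml logit_potential /gibbs /= -/(E w).
  by rewrite mulrA divfK ?(row_n0 PartyB w.2) //.
rewrite -[RHS]mul1r -chi_sum1 mulrDl -{1}stepA -stepB !mulr_sumr -big_split.
by apply: eq_bigr => z _; rewrite /= /revision mulrDr; congr (_ + _); rewrite mulrCA.
Qed.

Lemma gibbs_unique : G != fset0 ->
  unique (stationary (@revision _ _ _ g G chi tau)) (gibbs g tau).
Proof.
move=> G0; split=> [|q]; first exact: gibbs_stationary.
apply: stationary_unique (gibbs_stationary G0); [exact: revision_ge0| |exact: gibbs_gt0].
(* A revises first, then B. *)
move=> z w; exists (w.1, z.2).
  exact: (@revision_gt0 PartyA).
exact: (@revision_gt0 PartyB).
Qed.

End LogitProcess.

Lemma gibbs_cvg (R : realType) (K N : nat) (g : platform_game R K N)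
    (G : {fset 'rV[R]_K}) (z : G * G) :
  gibbs g t z @[t --> 0^'+] -->
    ((z \in maximizers g G)%:R / #|maximizers g G|%:R : R).
Proof. exact: (@gibbs_measure_cvg _ _ (fun z : G * G => Phi g (emb z)) z). Qed.

(** Any stationary family agrees with the Gibbs family for [t > 0], hence has the same right limit
    at 0. *)
Lemma stochastically_stableP (R : realType) (K N : nat) (g : platform_game R K N)
    (G : {fset 'rV[R]_K}) (chi : party -> R) (z : G * G) :
  (forall t, 0 < t -> unique (stationary (@revision _ _ _ g G chi t)) (gibbs g t)) ->
  stochastically_stable g chi z <-> z \in maximizers g G.
Proof.
move=> uniq; split=> [[q [qstat qlim]]|zmax].
  apply: contrapT => /negP/negbTE zmax; apply: qlim.
  have := @gibbs_cvg _ _ _ g G z; rewrite zmax mul0r; apply: cvg_trans.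
  apply: near_eq_cvg; near=> t.
  have t0 : 0 < t by near: t; exact: nbhs_right_gt.
  by have [_ /(_ _ (qstat t t0)) ->] := uniq t t0.
exists (@gibbs _ _ _ g G); split=> [t t0|]; first by have [] := uniq t t0.
have := @gibbs_cvg _ _ _ g G z; rewrite zmax mul1r => glim g0.
(* An inverse vanishes only at 0, so the set of maximizers would be empty although it contains
   [z]. *)
have /eqP : #|maximizers g G|%:R^-1 = 0 :> R.
  exact: (cvg_unique _ glim g0).
rewrite invr_eq0 pnatr_eq0 cards_eq0 => /eqP max0.
by move: zmax; rewrite max0 finset.inE.
Unshelve. all: by end_near.
Qed.

Theorem mainTheorem12 (R : realType) (K N : nat) (g : platform_game R K N)
    (chi : party -> R) (chi_gt0 : forall p, 0 < chi p)
    (chi_sum1 : chi PartyA + chi PartyB = 1) :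
  (forall G : {fset 'rV[R]_K}, G != fset0 -> [set` G] `<=` D g ->
    [/\ forall tau : R, 0 < tau ->
          unique (stationary (@revision _ _ _ g G chi tau)) (gibbs g tau),
        forall z : G * G, z \in maximizers g G ->
          gibbs g tau z @[tau --> 0^'+] --> (#|maximizers g G|%:R^-1 : R),
        forall z : G * G, z \notin maximizers g G ->
          gibbs g tau z @[tau --> 0^'+] --> 0 &
        forall z : G * G,
          stochastically_stable g chi z <-> z \in maximizers g G])
  /\
  (forall (G : nat -> {fset 'rV[R]_K}) (xs : forall n, G n * G n),
    (forall n, [set` G n] `<=` D g) ->
    mesh g (G n) @[n --> \oo] --> 0%E ->
    (forall n, xs n \in maximizers g (G n)) ->
    forall z : 'rV[R]_K * 'rV[R]_K,
      cluster ((fun n => emb (xs n)) @ \oo) z ->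
      argmax (D g `*` D g) (Phi g) z /\
      (strictly_concave_on `[0, 1] (nu g) -> party_preferred g z)).
Proof.
split=> [G G0 GD|G xs GD Gmesh xsmax z zcl].
  have uniq tau : 0 < tau ->
      unique (stationary (@revision _ _ _ g G chi tau)) (gibbs g tau).
    by move=> _; exact: gibbs_unique.
  split=> // [z zmax|z /negbTE zmax|z]; last exact: stochastically_stableP.
    by have := @gibbs_cvg _ _ _ g G z; rewrite zmax mul1r.
  by have := @gibbs_cvg _ _ _ g G z; rewrite zmax mul0r.
have zmax := cluster_grid_maximizers GD Gmesh xsmax zcl.
split=> // /strictly_concave_increments dec; exact: argmax_party_preferred.
Qed.
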